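(* Let $I=I_M$ be a generalized Gorenstein ideal of homological dimension $3$ with maximal $\zeta(I)$ (that is, $\zeta(I)=\nu(I)-3$), where $M=(AK\,|\,C)$ is a minimal presentation matrix of size $n$, with $A\in R^{n,3}$, $C\in R^{n,n-3}$ and $$K=\begin{pmatrix}0 & h_3 & -h_2\\ -h_3 &0 & h_1\\ h_2 & -h_1 & 0\end{pmatrix},$$ where $(h_1,h_2,h_3,0,\ldots,0)=\gamma(M^T)$ is the vector of the last map of the minimal free resolution of $R/I$ and $h_1,h_2,h_3$ is a regular sequence. Then $I$ is generated by the maximal minors obtained by deleting, one by one, the first $n$ rows of the $(n+1)\times n$ matrix $$B=\begin{pmatrix} & A & & & C &\\ h_1 &h_2 & h_3 & 0 &\ldots & 0 \end{pmatrix}.$$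
   Context: $k$ is a field and $R=k[x_1,\ldots,x_r]$, $r\ge 3$, standard graded; ideals, matrices and maps are homogeneous; $n\ge 3$. $R^{p,q}$ denotes the $p\times q$ matrices over $R$. A matrix $M\in R^{n,n}$ is a presentation matrix if it is the matrix of a map $\varphi$ in an exact sequence $R^n\xrightarrow{\varphi}R^n\to R$. For $N\in R^{n,n-1}$ put $g_i(N)=(-1)^{i+1}N_i$, where $N_i$ is the minor obtained by deleting the $i$-th row of $N$. If $M\in R^{n,n}$ has rank $n-1$, choose $n-1$ columns of $M$ forming a submatrix $N$ of rank $n-1$ and set $\gamma(M)=(g_1(N)/d,\ldots,g_n(N)/d)$ with $d=\gcd(g_1(N),\ldots,g_n(N))$ (well defined up to a unit); $I_M$ is the ideal generated by the components of $\gamma(M)$. If $M$ is a presentation matrix then $0\to R\xrightarrow{\gamma(M^T)^T}R^n\xrightarrow{M}R^n\xrightarrow{\gamma(M)}R\to R/I_M\to0$ is a free resolution; $M$ is called a minimal presentation matrix if this resolution is minimal. A homogeneous ideal $I$ (or $R/I$) of homological dimension $3$ (i.e. $R/I$ has projective dimension $3$) is generalized Gorenstein if the last module in the graded minimal free resolution of $R/I$ has rank $1$. If $0\to R\xrightarrow{\rho}R^n\to R^n\to R\to R/I\to 0$ is a minimal free resolution (shifts omitted), $I(\rho)$ is the ideal generated by the components of $\rho(1)$, $\nu(\cdot)$ denotes the minimal number of generators, and $\zeta(I)=\nu(I)-\nu(I(\rho))$; one has $0\le\zeta(I)\le\nu(I)-3$. When $\zeta(I)=\nu(I)-3$, bases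 can be chosen so that $\rho(1)=(h_1,h_2,h_3,0,\ldots,0)$ with $(h_1,h_2,h_3)$ a regular sequence, and then $I=I_M$ for a minimal presentation matrix of the form $M=(AK|C)$. *)

(* Defs.v *)
(* The ring k[x_1, ..., x_r] is {mpoly k[r]}. *)
From mathcomp Require Export all_boot all_order all_algebra.
From mathcomp.multinomials Require Export mpoly.

Set Implicit Arguments.
Unset Strict Implicit.
Unset Printing Implicit Defensive.

Import GRing.Theory.
Local Open Scope ring_scope.

Section Ring.
Variable R : comNzRingType.

(* Ideals are Prop-valued predicates on R, compared by logical equivalence. *)
Definition ideal_gen (J : finType) (g : J -> R) : R -> Prop :=
  fun f => exists c : J -> R, f = \sum_j c j * g j.

Definition ideal_eq (I J : R -> Prop) : Prop := forall f, I f <-> J f.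

Definition rdvd (d f : R) : Prop := exists q, f = q * d.

Definition is_gcd (J : finType) (g : J -> R) (d : R) : Prop :=
  (forall j, rdvd d (g j)) /\ (forall e, (forall j, rdvd e (g j)) -> rdvd e d).

(* h_1, ..., h_m is a regular sequence: h_i is a nonzerodivisor modulo
   (h_1, ..., h_(i-1)), and (h_1, ..., h_m) is a proper ideal. *)
Definition regular_sequence m (h : 'rV[R]_m) : Prop :=
  (forall i : 'I_m,
     let before := ideal_gen (fun j : {j : 'I_m | (j < i)%N} => h 0 (val j)) in
     forall f, before (f * h 0 i) -> before f)
  /\ ~ ideal_gen (h 0) 1.

(* Matrices act on column vectors. *)
Definition exact_mx p q s (psi : 'M[R]_(p, q)) (phi : 'M[R]_(q, s)) : Prop :=
  forall u : 'cV[R]_q, psi *m u = 0 <-> exists w : 'cV[R]_s, u = phi *m w.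

Definition injective_mx q s (phi : 'M[R]_(q, s)) : Prop :=
  forall u : 'cV[R]_s, phi *m u = 0 -> u = 0.

(* nu(I) = s *)
Definition min_num_gens (I : R -> Prop) (s : nat) : Prop :=
  (exists g : 'I_s -> R, ideal_eq I (ideal_gen g)) /\
  (forall t (g : 'I_t -> R), ideal_eq I (ideal_gen g) -> (s <= t)%N).

(* The sign is (-1)^i, as rows are numbered from 0. *)
Definition gminor n (N : 'M[R]_(n, n.-1)) (i : 'I_n) : R :=
  (-1) ^+ i * \det (row' i N).

Definition koszul (h : 'rV[R]_3) : 'M[R]_3 :=
  let h1 := h 0 0 in let h2 := h 0 1 in let h3 := h 0 2%:R in
  \matrix_(i, j) nth 0 (nth [::] [:: [::   0;  h3; - h2];
                                     [:: - h3;  0;   h1];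
                                     [::  h2; - h1;   0]] i) j.

(* The matrix (M ; h) with the row h appended at the bottom. *)
Definition append_row n (M : 'M[R]_n) (h : 'rV[R]_n) : 'M[R]_(n.+1, n) :=
  castmx (addn1 n, erefl n) (col_mx M h).

(* Deletion of one of the first n rows. *)
Definition maxminor n (B : 'M[R]_(n.+1, n)) (i : 'I_n) : R :=
  \det (row' (widen_ord (leqnSn n) i) B).

End Ring.

Section Rank.
Variable R : idomainType.

(* Rank over a domain is the rank over its field of fractions. *)
Definition rank_mx m n (M : 'M[R]_(m, n)) : nat :=
  \rank (map_mx (@FracField.tofrac R) M).

(* "v is gamma(M)": gamma(M) is defined up to a unit only, and every choice of
   the n-1 columns (all columns but the j-th) and of the gcd is allowed. *)
Definition is_gamma n (M : 'M[R]_n) (v : 'rV[R]_n) : Prop :=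
  rank_mx M = n.-1 /\
  exists j : 'I_n,
    rank_mx (col' j M) = n.-1 /\
    exists d, is_gcd (gminor (col' j M)) d /\
              forall i, gminor (col' j M) i = v 0 i * d.

(* I = I_M *)
Definition is_ideal_of n (M : 'M[R]_n) (I : R -> Prop) : Prop :=
  exists v, is_gamma M v /\ ideal_eq I (ideal_gen (v 0)).

End Rank.

Section Graded.
Variables (k : fieldType) (r : nat).
Local Notation R := {mpoly k[r]}.

Definition homogeneous_ideal (I : R -> Prop) : Prop :=
  forall f, I f -> forall d : nat, I (pihomog mdeg d f).

(* M is a degree 0 map (+)_j R(-b_j) -> (+)_i R(-a_i). *)
Definition graded_mx m n (a : 'I_m -> int) (b : 'I_n -> int)
    (M : 'M[R]_(m, n)) : Prop :=
  forall i j, M i j != 0 ->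
    exists2 d : nat, b j = a i + d%:Z & M i j \is d.-homog.

Definition homogeneous_mx m n (M : 'M[R]_(m, n)) : Prop :=
  exists a b, graded_mx a b M.

(* All entries lie in the ideal (x_1, ..., x_r). *)
Definition minimal_mx m n (M : 'M[R]_(m, n)) : Prop :=
  forall i j, (M i j)@_0%MM = 0.

(* 0 -> R^p -> R^m -> R^n -> R is a graded minimal free resolution of the
   quotient of R by the image of phi1. *)
Definition min_free_res n m p (phi1 : 'rV[R]_n) (phi2 : 'M[R]_(n, m))
    (phi3 : 'M[R]_(m, p)) : Prop :=
  [/\ exists a b c,
        [/\ graded_mx (fun=> 0) a phi1, graded_mx a b phi2
          & graded_mx b c phi3],
      [/\ exact_mx phi1 phi2, exact_mx phi2 phi3 & injective_mx phi3]
    & [/\ minimal_mx phi1, minimal_mx phi2 & minimal_mx phi3]].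

(* 0 -> R -rho-> R^m -> R^n -> R is the minimal free resolution of R/I.
   Additivity of ranks forces n = m. *)
Definition is_last_map (I : R -> Prop) m (rho : 'cV[R]_m) : Prop :=
  exists n (phi1 : 'rV[R]_n) (phi2 : 'M[R]_(n, m)),
    min_free_res phi1 phi2 rho /\ ideal_eq I (ideal_gen (phi1 0)).

(* Generalized Gorenstein of homological dimension 3: the minimal free
   resolution has length 3 and its last module has rank 1. *)
Definition generalized_gorenstein3 (I : R -> Prop) : Prop :=
  homogeneous_ideal I /\ exists m (rho : 'cV[R]_m), is_last_map I rho.

(* zeta(I) = z *)
Definition is_zeta (I : R -> Prop) (z : int) : Prop :=
  exists m (rho : 'cV[R]_m) (s t : nat),
    [/\ is_last_map I rho, min_num_gens I s,
        min_num_gens (ideal_gen (fun i => rho i 0)) t & z = s%:Z - t%:Z].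

Definition maximal_zeta (I : R -> Prop) : Prop :=
  exists s, min_num_gens I s /\ is_zeta I (s%:Z - 3%:Z).

Definition presentation_mx n (M : 'M[R]_n) : Prop :=
  exists psi : 'rV[R]_n,
    (exists a b, graded_mx (fun=> 0) a psi /\ graded_mx a b M) /\
    exact_mx psi M.

Definition minimal_presentation_mx n (M : 'M[R]_n) : Prop :=
  presentation_mx M /\
  exists v w, [/\ is_gamma M v, is_gamma M^T w & min_free_res v M w^T].

End Graded.

(* Main.v *)
Require Import Defs.
From mathcomp Require Import perm ring.

Set Implicit Arguments.
Unset Strict Implicit.
Unset Printing Implicit Defensive.

Import GRing.Theory.
Local Open Scope ring_scope.

(** Put N = (A | C), let D be the block diagonal matrix with blocks K and 1,
    so that M = N D, and let w = (h, 0) adj(N).  Expanding the n maximal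
    minors of B along the last row shows that they are, up to sign, the
    entries of w.  The statement thus says that w and gamma(M) agree up to a
    unit.

    Since adj(K) = h^T h and det(K) = 0, multiplicativity of the adjugate gives
    adj(M) = adj(D) adj(N) = (h, 0)^T w.  A row of adj(M) is on the one hand
    a multiple of w by an entry of (h, 0), and on the other hand gamma(M)
    times the gcd of that row; hence w = e gamma(M) for some nonzero e
    ([gamma_scale]), and everything lies in proving that e is a unit.

    This is where exactness of the resolution enters.  As e divides w, it
    divides all (n-1)-minors of M.  For q < n-1, [minors_dvd_descent] shows
    that if e divides all (q+1)-minors of M, then it divides all q-minors; going
    down to the empty minor gives that e divides 1 ([dvd_adj_unit]).  This
    replaces the depth argument in the Buchsbaum-Eisenbud criterion.  The
    descent uses that
    - a vector x with M x = 0 modulo e is, modulo e, a multiple of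
      rho = (h, 0)^T: if M x = e y, then gamma(M) y = 0, so y = M z and x - e z
      lies in the kernel of M, which is generated by rho ([syzygy_lift]);
    - q rows and q+1 columns of M give such an x, whose entries are the signed
      q-minors on these rows and q of the columns ([minor_syzygy]);
    - multiplication by h_1 and h_2 detects zero modulo e, because h_1, h_2 is
      a regular sequence ([regular_grade2]). *)

(** * Minors indexed by functions *)

(** The image of [f] misses exactly one index [i], so after closing the gap at
    [i] it becomes a permutation. *)
Lemma inj_lift_perm n (f : 'I_n -> 'I_n.+1) : injective f ->
  exists (i : 'I_n.+1) (s : 'S_n), forall a, f a = lift i (s a).
Proof.
move=> inj_f.
have [i fi] : exists i, forall a, i != f a.
  suff /set0Pn[i] : ~: [set f a | a : 'I_n] != set0.
    rewrite inE => /imsetP nfi; exists i => a; apply/eqP=> ifa.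
    by case: nfi; exists a.
  rewrite -card_gt0 cardsCs setCK card_ord.
  by rewrite card_imset // card_ord subSnn.
have /fin_all_exists[g fg] : forall a, exists b, f a = lift i b.
  by move=> a; case: (unlift_some (fi a)) => b -> _; exists b.
have inj_g : injective g by move=> a b gab; apply: inj_f; rewrite !fg gab.
by exists i, (perm inj_g) => a; rewrite permE.
Qed.

Section Minors.
Variable R : comNzRingType.

Definition ocons n q (i : 'I_n) (f : 'I_q -> 'I_n) (a : 'I_q.+1) : 'I_n :=
  oapp f i (unlift ord0 a).

Lemma ocons0 n q (i : 'I_n) (f : 'I_q -> 'I_n) : ocons i f ord0 = i.
Proof. by rewrite /ocons unlift_none. Qed.

Lemma oconsS n q (i : 'I_n) (f : 'I_q -> 'I_n) a :
  ocons i f (lift ord0 a) = f a.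
Proof. by rewrite /ocons liftK. Qed.

Lemma eq_minor n q (M : 'M[R]_n) (I I' J J' : 'I_q -> 'I_n) :
  I =1 I' -> J =1 J' -> \det (mxsub I J M) = \det (mxsub I' J' M).
Proof.
by move=> eqI eqJ; congr (\det _); apply/matrixP=> i j; rewrite !mxE eqI eqJ.
Qed.

Lemma minor_noninj n q (M : 'M[R]_n) (I J : 'I_q -> 'I_n) :
  ~~ injectiveb J -> \det (mxsub I J M) = 0.
Proof.
case/injectivePn=> a [b neq_ab eqJ]; rewrite -det_tr.
by apply: (determinant_alternate neq_ab) => i; rewrite !mxE eqJ.
Qed.

(** A minor of size [n] of a square matrix of size [n+1] is zero if a row or
    column is repeated, and an entry of the adjugate up to sign otherwise. *)
Lemma minor_adj n (M : 'M[R]_n.+1) (I J : 'I_n -> 'I_n.+1) :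
  exists i j c, \det (mxsub I J M) = c * \adj M j i.
Proof.
have [injI|nI] := boolP (injectiveb I); last first.
  exists ord0, ord0, 0; rewrite mul0r -det_tr trmx_mxsub.
  exact: minor_noninj.
have [injJ|nJ] := boolP (injectiveb J); last first.
  by exists ord0, ord0, 0; rewrite mul0r minor_noninj.
have [i [s eqI]] := inj_lift_perm (injectiveP _ injI).
have [j [t eqJ]] := inj_lift_perm (injectiveP _ injJ).
exists i, j, ((-1) ^+ s * (-1) ^+ t * (-1) ^+ (i + j)).
rewrite mxE /cofactor (eq_minor _ eqI eqJ).
have -> : mxsub (fun a => lift i (s a)) (fun b => lift j (t b)) M
        = perm_mx s *m row' i (col' j M) *m perm_mx t^-1.
  by rewrite -row_permE -col_permE; apply/matrixP=> a b; rewrite !mxE.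
rewrite !det_mulmx !det_perm odd_permV -!mulrA; congr (_ * _).
by rewrite [LHS]mulrC signrMK.
Qed.
End Minors.

(** * Descent on the size of the minors *)

Section Divisibility.
Variable R : comNzRingType.
Implicit Types e f g : R.

Lemma rdvd0 e : rdvd e 0.
Proof. by exists 0; rewrite mul0r. Qed.

Lemma rdvdD e f g : rdvd e f -> rdvd e g -> rdvd e (f + g).
Proof. by move=> [a ->] [b ->]; exists (a + b); rewrite mulrDl. Qed.

Lemma rdvdMl e f g : rdvd e g -> rdvd e (f * g).
Proof. by move=> [a ->]; exists (f * a); rewrite mulrA. Qed.

End Divisibility.

Section Descent.
Variables (R : idomainType) (n : nat).
Variables (v : 'rV[R]_n.+1) (M : 'M[R]_n.+1) (rho : 'cV[R]_n.+1).
Hypothesis exact_vM : exact_mx v M.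
Hypothesis exact_Mrho : exact_mx M rho.
Variable e : R.
Hypothesis e_neq0 : e != 0.

(** Exactness of the complex survives in part modulo [e]: because [e] can be
    cancelled in [v *m (e *: y) = 0], a kernel vector of [M] modulo [e] lifts
    to a kernel vector of [M]. *)
Lemma syzygy_lift (x : 'cV[R]_n.+1) : (forall i, rdvd e ((M *m x) i 0)) ->
  exists c, forall p, rdvd e (x p 0 - c * rho p 0).
Proof.
move=> /fin_all_exists[y Mx].
have {}Mx : M *m x = e *: \col_i y i.
  by apply/matrixP=> i j; rewrite !mxE ord1 -mulrC -Mx mxE.
have /exact_vM[z yz] : v *m (\col_i y i) = 0.
  have : e *: (v *m \col_i y i) = 0.
    by rewrite scalemxAr -Mx; apply/exact_vM; exists x.
  by move/eqP; rewrite scalemx_eq0 (negPf e_neq0) => /eqP.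
have /exact_Mrho[c xc] : M *m (x - e *: z) = 0.
  by rewrite mulmxBr Mx yz -scalemxAr subrr.
exists (c 0 0) => p; exists (z p 0).
have : (x - e *: z) p 0 = (rho *m c) p 0 by rewrite xc.
by rewrite !mxE big_ord1 => xp; rewrite [c 0 0 * _]mulrC -xp; ring.
Qed.

(** The index functions need not be injective nor increasing: this keeps the
    statement stable under adding and dropping an index. *)
Definition minors_dvd q :=
  forall I J : 'I_q -> 'I_n.+1, rdvd e (\det (mxsub I J M)).

(** The vector of signed minors is a kernel vector modulo [e]: multiplying it by
    row [i] of [M] gives, by Laplace expansion, the minor with row [i] added,
    and this one is divisible by [e]. *)
Lemma minor_syzygy q (I : 'I_q -> 'I_n.+1) (L : 'I_q.+1 -> 'I_n.+1) :
  minors_dvd q.+1 ->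
  exists c, forall p,
    rdvd e (\sum_(l : 'I_q.+1 | L l == p) (-1) ^+ l * \det (mxsub I (L \o lift l) M)
            - c * rho p 0).
Proof.
move=> dvd_minors.
pose m (l : 'I_q.+1) := (-1) ^+ l * \det (mxsub I (L \o lift l) M).
have [i|c xc] := @syzygy_lift (\col_p \sum_(l : 'I_q.+1 | L l == p) m l);
  last by exists c => p; have := xc p; rewrite mxE.
suff -> : (M *m \col_p (\sum_(l : 'I_q.+1 | L l == p) m l)) i 0
        = \det (mxsub (ocons i I) L M) by apply: dvd_minors.
rewrite mxE (expand_det_row _ ord0).
rewrite [RHS](partition_big L predT) //=; apply: eq_bigr => p _.
rewrite mxE big_distrr /=; apply: eq_bigr => l /eqP <-.
rewrite !mxE ocons0 /cofactor add0n; congr (_ * (_ * \det _)).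
by apply/matrixP=> a b; rewrite !mxE oconsS.
Qed.

Lemma sum_ocons_head q (J : 'I_q -> 'I_n.+1) l (F : 'I_q.+1 -> R) :
  (forall t, J t != l) -> \sum_(a | ocons l J a == l) F a = F ord0.
Proof.
move=> Jl; apply: big_pred1 => a /=.
case: (unliftP ord0 a) => [b|] ->; last by rewrite ocons0 !eqxx.
by rewrite oconsS (negPf (Jl b)).
Qed.

Lemma sum_ocons_tail q (J : 'I_q -> 'I_n.+1) l t (F : 'I_q.+1 -> R) :
  injective J -> (forall s, J s != l) ->
  \sum_(a | ocons l J a == J t) F a = F (lift ord0 t).
Proof.
move=> injJ Jl; apply: big_pred1 => a /=.
case: (unliftP ord0 a) => [b|] ->.
  by rewrite oconsS (inj_eq injJ) (inj_eq lift_inj).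
by rewrite ocons0 [LHS]eq_sym (negPf (Jl t)).
Qed.

Lemma sum_ocons_missed q (J : 'I_q -> 'I_n.+1) l l' (F : 'I_q.+1 -> R) :
  l != l' -> (forall t, J t != l') -> \sum_(a | ocons l J a == l') F a = 0.
Proof.
move=> neq_ll Jl'; apply: big_pred0 => a.
case: (unliftP ord0 a) => [b|] ->; first by rewrite oconsS (negPf (Jl' b)).
by rewrite ocons0 (negPf neq_ll).
Qed.

(** The case where the columns are those of [J] and a further one [l]: entry
    [l] of the kernel vector is then the minor on [J], and entry [l'] is
    zero. *)
Lemma minor_syzygy_missed q (I J : 'I_q -> 'I_n.+1) l l' :
  minors_dvd q.+1 ->
  l != l' -> (forall t, J t != l) -> (forall t, J t != l') ->
  exists c, [/\ rdvd e (\det (mxsub I J M) - c * rho l 0),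
                rdvd e (c * rho l' 0)
      & forall p,
        rdvd e (\sum_(a : 'I_q.+1 | ocons l J a == p)
                  (-1) ^+ a * \det (mxsub I (ocons l J \o lift a) M)
                - c * rho p 0)].
Proof.
move=> dvd_minors neq_ll Jl Jl'.
have [c xc] := minor_syzygy I (ocons l J) dvd_minors; exists c; split=> //.
- have := xc l; rewrite sum_ocons_head // mul1r; congr (rdvd e (_ - _)).
  by apply: eq_minor => // a /=; rewrite oconsS.
- have := xc l'; rewrite sum_ocons_missed // sub0r => /(rdvdMl (-1)).
  by rewrite mulN1r opprK.
Qed.

(** If the kernel vector is [c * rho] modulo [e] and D is the minor, then
    D = c rho_l and c rho_l' = 0, so D rho_l' = c rho_l rho_l' = 0. *)
Lemma minor_mul_missed q (I J : 'I_q -> 'I_n.+1) l l' : minors_dvd q.+1 ->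
  l != l' -> (forall t, J t != l) -> (forall t, J t != l') ->
  rdvd e (\det (mxsub I J M) * rho l' 0).
Proof.
move=> dvd_minors neq_ll Jl Jl'.
have [c [Dc cl' _]] := minor_syzygy_missed I dvd_minors neq_ll Jl Jl'.
have := rdvdD (rdvdMl (rho l' 0) Dc) (rdvdMl (rho l 0) cl').
by congr (rdvd e _); ring.
Qed.

(** For [p = J t] the entry [p] of the kernel vector c rho is, up to sign, the
    minor D' obtained from D by exchanging column [p] for [l].  Hence
    D rho_p = c rho_l rho_p is rho_l D' up to sign, and D' rho_p = 0 by
    [minor_mul_missed], since D' misses [p]. *)
Lemma minor_mul_hit q (I J : 'I_q -> 'I_n.+1) l l' t : minors_dvd q.+1 ->
  injective J -> l != l' -> (forall t, J t != l) -> (forall t, J t != l') ->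
  rdvd e (\det (mxsub I J M) * rho (J t) 0 ^+ 2).
Proof.
move=> dvd_minors injJ neq_ll Jl Jl'.
have [c [Dc _ /(_ (J t))]] := minor_syzygy_missed I dvd_minors neq_ll Jl Jl'.
rewrite sum_ocons_tail //.
set J' := _ \o _ => xt.
have J'l' s : J' s != l'.
  rewrite /J' /=; case: (unliftP ord0 (lift (lift ord0 t) s)) => [b|] ->.
    by rewrite oconsS.
  by rewrite ocons0.
have J't s : J' s != J t.
  rewrite /J' /=; case: (unliftP ord0 (lift (lift ord0 t) s)) => [b|] eqs.
    rewrite eqs oconsS (inj_eq injJ); apply/eqP=> bt.
    by move: (neq_lift (lift ord0 t) s); rewrite eqs bt eqxx.
  by rewrite eqs ocons0 eq_sym.
have D'p : rdvd e (\det (mxsub I J' M) * rho (J t) 0).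
  by apply: (@minor_mul_missed _ _ _ l') => //; rewrite eq_sym.
set D := \det _ in Dc *; set D' := \det _ in xt D'p.
set p := rho _ _ in xt D'p *.
have := rdvdD (rdvdMl (p ^+ 2) Dc) (rdvdD (rdvdMl (- p * rho l 0) xt)
  (rdvdMl (rho l 0 * (-1) ^+ lift ord0 t) D'p)).
by congr (rdvd e _); ring.
Qed.

Lemma missed_pair q (J : 'I_q -> 'I_n.+1) : (q < n)%N ->
  exists l l', [/\ l != l', forall t, J t != l & forall t, J t != l'].
Proof.
move=> lt_qn; have : (1 < #|~: [set J t | t : 'I_q]|)%N.
  rewrite cardsCs setCK card_ord -subn_gt0 -subnDA addn1 subn_gt0 ltnS.
  by apply: leq_ltn_trans (leq_imset_card _ _) _; rewrite card_ord.
case/card_gt1P=> l [l' []]; rewrite !inE => /imsetP nl /imsetP nl' neq.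
by exists l, l'; split=> // t; apply/eqP=> eqJ; [case: nl | case: nl']; exists t.
Qed.

Variables i0 i1 : 'I_n.+1.
Hypothesis grade2 : forall f,
  rdvd e (f * rho i0 0) -> rdvd e (f * rho i1 0) -> rdvd e f.

(** If a^2 and b^2 kill f modulo [e], then both a and b kill f a b, so f a b is
    zero; then f a and f b are killed by a and b as well. *)
Lemma grade2_squares f :
  rdvd e (f * rho i0 0 ^+ 2) -> rdvd e (f * rho i1 0 ^+ 2) -> rdvd e f.
Proof.
set a := rho i0 0; set b := rho i1 0 => faa fbb.
have fab : rdvd e (f * a * b).
  apply: grade2; rewrite -/a -/b.
    by have := rdvdMl b faa; congr (rdvd e _); ring.
  by have := rdvdMl a fbb; congr (rdvd e _); ring.
apply: grade2; apply: grade2; rewrite -/a -/b //.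
- by rewrite -mulrA.
- by rewrite mulrAC.
- by rewrite -mulrA.
Qed.

(** A minor with two columns missing is killed modulo [e] by the square of every
    entry of [rho], hence zero modulo [e]. *)
Lemma minors_dvd_descent q : (q < n)%N -> minors_dvd q.+1 -> minors_dvd q.
Proof.
move=> lt_qn dvd_minors I J.
have [/injectiveP injJ|nJ] := boolP (injectiveb J); last first.
  by rewrite minor_noninj //; apply: rdvd0.
have dvd_sq p : rdvd e (\det (mxsub I J M) * rho p 0 ^+ 2).
  have [l [l' [neq_ll Jl Jl']]] := missed_pair J lt_qn.
  have [t /eqP <-|nJp] := pickP (fun t => J t == p).
    exact: minor_mul_hit neq_ll Jl Jl'.
  have Jp t : J t != p by rewrite nJp.
  rewrite expr2 mulrCA; apply: rdvdMl.
  have [eq_lp|neq_lp] := eqVneq l p.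
    by apply: (@minor_mul_missed q I J l' p) => //; rewrite -eq_lp eq_sym.
  exact: (@minor_mul_missed q I J l p).
exact: grade2_squares.
Qed.

Lemma dvd_adj_unit : (forall i j, rdvd e (\adj M j i)) -> rdvd e 1.
Proof.
move=> dvd_adj.
have dvdn : minors_dvd n.
  by move=> I J; have [i [j [c ->]]] := minor_adj M I J; apply: rdvdMl.
suff dvd0 q : (q <= n)%N -> minors_dvd q -> minors_dvd 0.
  have := dvd0 n (leqnn n) dvdn (fun=> ord0) (fun=> ord0).
  by rewrite det_mx00.
elim: q => // q IHq le_qn dvdq; apply: IHq; first exact: ltnW.
exact: minors_dvd_descent.
Qed.
End Descent.

(** * Adjugates of products and of the Koszul matrix *)

Lemma adj_uniq (R : idomainType) n (A B : 'M[R]_n) :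
  \det A != 0 -> A *m B = (\det A)%:M -> B = \adj A.
Proof.
move=> dA AB; apply/eqP; rewrite -subr_eq0.
have : \det A *: (B - \adj A) == 0.
  by rewrite -mul_scalar_mx -mul_adj_mx -mulmxA mulmxBr AB mul_mx_adj subrr mulmx0.
by rewrite scalemx_eq0 (negPf dA).
Qed.

Section Adjugate.
Variable R : idomainType.

(** This is A + X: adding the variable to the diagonal makes the determinant
    nonzero, and X = 0 gives A back, so that identities between adjugates need
    only be shown for matrices with nonzero determinant. *)
Definition perturb n (A : 'M[R]_n) : 'M[{poly R}]_n := char_poly_mx (- A).

Lemma det_perturb_neq0 n (A : 'M[R]_n) : \det (perturb A) != 0.
Proof. exact/monic_neq0/char_poly_monic. Qed.

Lemma perturbK n (A : 'M[R]_n) : map_mx (horner_eval 0) (perturb A) = A.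
Proof.
apply/matrixP=> i j.
by rewrite !mxE /horner_eval hornerD hornerN hornerMn hornerX hornerC
           mul0rn sub0r opprK.
Qed.

Lemma adj_mulmx n (A B : 'M[R]_n) : \adj (A *m B) = \adj B *m \adj A.
Proof.
suff adjAB : \adj (perturb A *m perturb B)
           = \adj (perturb B) *m \adj (perturb A).
  have := congr1 (map_mx (horner_eval 0)) adjAB.
  by rewrite map_mxM !map_mx_adj map_mxM !perturbK.
apply/esym; apply: adj_uniq; rewrite det_mulmx ?mulf_neq0 ?det_perturb_neq0 //.
rewrite mulmxA -(mulmxA _ (perturb B)) mul_mx_adj -mulmxA mul_scalar_mx.
by rewrite -scalemxAr mul_mx_adj scale_scalar_mx mulrC.
Qed.

Lemma adj_block_mx1 p q (A : 'M[R]_p) :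
  \adj (block_mx A 0 0 (1%:M : 'M_q)) = block_mx (\adj A) 0 0 (\det A)%:M.
Proof.
suff adjA : \adj (block_mx (perturb A) 0 0 (1%:M : 'M_q))
          = block_mx (\adj (perturb A)) 0 0 (\det (perturb A))%:M.
  have := congr1 (map_mx (horner_eval 0)) adjA.
  rewrite map_mx_adj !map_block_mx map_mx_adj !map_mx0 !map_scalar_mx.
  by rewrite -det_map_mx perturbK /= rmorph1.
apply/esym; apply: adj_uniq; rewrite det_ublock det1 mulr1 ?det_perturb_neq0 //.
rewrite mulmx_block !mul0mx !mulmx0 !addr0 !add0r mul1mx mul_mx_adj.
by rewrite -scalar_mx_block.
Qed.

End Adjugate.

Section Koszul.
Variable R : comNzRingType.
Implicit Type h : 'rV[R]_3.

Lemma adj_koszul h : \adj (koszul h) = h^T *m h.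
Proof.
have h0 p : h ord0 (@Ordinal 3 0 p) = h 0 0 by congr (h _ _); apply: val_inj.
have h1 p : h ord0 (@Ordinal 3 1 p) = h 0 1 by congr (h _ _); apply: val_inj.
have h2 p : h ord0 (@Ordinal 3 2 p) = h 0 2%:R.
  by congr (h _ _); apply: val_inj.
apply/matrixP=> i j; rewrite !mxE big_ord1 !mxE /cofactor.
rewrite (expand_det_row _ ord0) !big_ord_recl big_ord0 /cofactor !det_mx11 !mxE.
case: i => -[|[|[|//]]] ? /=; case: j => -[|[|[|//]]] ? //=;
  rewrite !(h0, h1, h2) /bump /=; ring.
Qed.

Lemma mul_koszul_tr h : koszul h *m h^T = 0.
Proof.
have h0 : ord0 = 0 :> 'I_3 by [].
have h1 : lift ord0 ord0 = 1 :> 'I_3 by apply: val_inj.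
have h2 : lift ord0 (lift ord0 ord0) = 2%:R :> 'I_3 by apply: val_inj.
apply/matrixP=> i j; rewrite !mxE !big_ord_recl big_ord0 !mxE h1 h2.
by rewrite [j]ord1 h0; case: i => -[|[|[|//]]] ? /=; ring.
Qed.

Lemma det_koszul h : \det (koszul h) = 0.
Proof.
have h0 : ord0 = 0 :> 'I_3 by [].
have h1 : lift ord0 ord0 = 1 :> 'I_3 by apply: val_inj.
have h2 : lift ord0 (lift ord0 ord0) = 2%:R :> 'I_3 by apply: val_inj.
have cof i j : cofactor (koszul h) i j = (h^T *m h) j i.
  by rewrite -adj_koszul mxE.
rewrite (expand_det_row _ ord0) !big_ord_recl big_ord0 !cof !mxE !big_ord1.
by rewrite !mxE h1 h2 h0 /=; ring.
Qed.

End Koszul.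

(** * The vector gamma *)

Section Gamma.

Lemma full_rank_minor (F : fieldType) n (N : 'M[F]_(n.+1, n)) :
  \rank N = n -> exists i, \det (row' i N) != 0.
Proof.
move=> rkN; have fullN : row_full N by rewrite /row_full rkN.
have [i [s fE]] := inj_lift_perm (@fullrankfun_inj _ _ _ _ fullN).
exists i; rewrite -unitfE -[_ \is a _]/(row' i N \in unitmx) -row_full_unit.
have := fullrowsub_full fullN.
have -> : rowsub (fullrankfun fullN) N = perm_mx s *m row' i N.
  by rewrite -row_permE; apply/matrixP=> a b; rewrite !mxE fE.
by rewrite -!sub1mx => /submx_trans; apply; apply: submxMl.
Qed.

Variables (R : idomainType) (n : nat).
Implicit Types (M : 'M[R]_n.+1) (u v w : 'rV[R]_n.+1).

Lemma adj_gminor M i j : \adj M j i = (-1) ^+ j * gminor (col' j M) i.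
Proof. by rewrite mxE /cofactor exprD mulrCA mulrA. Qed.

(** Row [j] of the adjugate consists of the minors of [col' j M] with a common
    sign, which moves into the gcd; the rank condition makes this gcd nonzero. *)
Lemma gamma_adj M v : is_gamma M v ->
  exists j d, [/\ d != 0, forall i, \adj M j i = v 0 i * d
    & forall e, (forall i, rdvd e (\adj M j i)) -> rdvd e d].
Proof.
case=> _ [j [rk [d [[_ d_max] vd]]]]; exists j, ((-1) ^+ j * d).
have adjE i : \adj M j i = v 0 i * ((-1) ^+ j * d).
  by rewrite adj_gminor vd mulrCA.
split=> //.
- have [i] := full_rank_minor rk.
  rewrite -map_row' det_map_mx tofrac_eq0 => minor_neq0.
  have : gminor (col' j M) i != 0 by rewrite mulf_neq0 ?signr_eq0.
  by rewrite vd mulf_eq0 negb_or mulf_eq0 signr_eq0 => /andP[].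
- move=> e dvd_e; apply: rdvdMl; apply: d_max => i.
  have := rdvdMl ((-1) ^+ j) (dvd_e i).
  by rewrite adj_gminor signrMK.
Qed.

Lemma gamma_coprime M v e : is_gamma M v ->
  (forall i, rdvd e (v 0 i)) -> rdvd e 1.
Proof.
move=> /gamma_adj[j [d [d_neq0 adjE d_max]]] dvd_v.
have [i|q dE] := d_max (e * d).
  by have [q vi] := dvd_v i; exists q; rewrite adjE vi mulrA.
by exists q; apply: (mulIf d_neq0); rewrite mul1r -mulrA -dE.
Qed.

(** If the adjugate has rank one, the entry [rho j 0] divides row [j], hence the
    gcd of that row; the quotient is the factor [e]. *)
Lemma gamma_scale M v (rho : 'cV[R]_n.+1) w :
  is_gamma M v -> \adj M = rho *m w -> exists2 e, e != 0 & w = e *: v.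
Proof.
move=> /gamma_adj[j [d [d_neq0 adjE d_max]]] adjM.
have {}adjM i : \adj M j i = w 0 i * rho j 0.
  by rewrite adjM mxE big_ord1 mulrC.
have [i|e dE] := d_max (rho j 0); first by exists (w 0 i); rewrite adjM.
move: d_neq0; rewrite dE mulf_eq0 negb_or => /andP[e_neq0 rho_neq0].
exists e => //; apply/matrixP=> a i; rewrite ord1 mxE; apply: (mulIf rho_neq0).
by rewrite -adjM adjE dE; ring.
Qed.

(** If [rho] is a multiple of a generator of the kernel of [M] and has no common
    factor, then it generates the kernel itself. *)
Lemma gamma_last_exact M (rho w : 'rV[R]_n.+1) :
  is_gamma M^T rho -> M *m rho^T = 0 -> exact_mx M w^T -> exact_mx M rho^T.
Proof.
move=> gamma_rho Mrho exMw.
have [c rhoE] := (exMw _).1 Mrho.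
have [q q1] : rdvd (c 0 0) 1.
  apply: gamma_coprime gamma_rho _ => i; exists (w 0 i).
  by have := congr1 (fun A : 'cV_n.+1 => A i 0) rhoE; rewrite !mxE big_ord1 !mxE.
have wE : w^T = q *: rho^T.
  apply/matrixP=> i j; rewrite rhoE !mxE big_ord1 !mxE ord1.
  by rewrite mulrCA -q1 mulr1.
move=> u; split=> [/exMw[x ->]|[x ->]]; last by rewrite mulmxA Mrho mul0mx.
by exists (q *: x); rewrite wE -scalemxAl -scalemxAr.
Qed.

End Gamma.

(** * The maximal minors of B *)

Section Main.

Lemma ideal_gen_sub (R : comNzRingType) (J : finType) (f g : J -> R) x :
  (forall j, exists c, g j = c * f j) -> ideal_gen g x -> ideal_gen f x.
Proof.
move=> /fin_all_exists[c gE] [a ->]; exists (fun j => a j * c j).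
by apply: eq_bigr => j _; rewrite gE mulrA.
Qed.

(** If f h_1 = a e and f h_2 = b e, then a h_2 = b h_1, so that a = c h_1 by
    regularity, and f = c e. *)
Lemma regular_grade2 (R : idomainType) (h : 'rV[R]_3) (e f : R) :
  regular_sequence h -> e != 0 ->
  rdvd e (f * h 0 0) -> rdvd e (f * h 0 1) -> rdvd e f.
Proof.
move=> [reg _] e_neq0 [a fh0] [b fh1].
have h0_neq0 : h 0 0 != 0.
  apply/eqP=> h00; have [|c] := reg 0 1.
    by exists (fun=> 0); rewrite h00 mulr0 big1 // => j _; rewrite mul0r.
  rewrite big1 => [/eqP|[j lt_j0] _]; first by rewrite oner_eq0.
  by have := lt_j0; rewrite ltn0.
have lt01 : ((0%R : 'I_3) < (1%R : 'I_3))%N by [].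
have before1 (F : {j : 'I_3 | (j < (1%R : 'I_3))%N} -> R) :
    \sum_j F j = F (exist _ 0 lt01).
  apply: big_pred1 => -[j lt_j1]; apply/esym/eqP; do 2!apply: val_inj.
  by apply/eqP; rewrite -leqn0 -ltnS.
have ah1 : a * h 0 1 = b * h 0 0.
  by apply: (mulIf e_neq0); rewrite mulrAC -fh0 [RHS]mulrAC -fh1; ring.
have [|c aE] := reg 1 a; first by exists (fun=> b); rewrite before1.
move: aE; rewrite before1 /= => aE.
exists (c (exist _ 0 lt01)); apply: (mulIf h0_neq0).
by rewrite fh0 aE; ring.
Qed.

Lemma maxminor_append_row (R : comNzRingType) n (N : 'M[R]_n.+1) g i :
  maxminor (append_row N g) i = (-1) ^+ (n + i) * (g *m \adj N) 0 i.
Proof.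
have appL (k : 'I_n.+2) (k' : 'I_n.+1) j : k = k' :> nat ->
  append_row N g k j = N k' j.
  move=> kE; rewrite castmxE /= cast_ord_id.
  rewrite (_ : cast_ord _ k = lshift 1 k') ?col_mxEu //.
  exact: val_inj.
have appR (k : 'I_n.+2) j : k = n.+1 :> nat -> append_row N g k j = g 0 j.
  move=> kE; rewrite castmxE /= cast_ord_id.
  rewrite (_ : cast_ord _ k = rshift n.+1 0) ?col_mxEd //.
  by apply: val_inj; rewrite /= addn0.
rewrite /maxminor (expand_det_row _ ord_max) mxE big_distrr /=.
apply: eq_bigr => l _; rewrite !mxE appR; last first.
  by rewrite /= /bump leq_ord add1n.
rewrite [RHS]mulrCA; congr (_ * _); rewrite /cofactor mulrA -exprD.
congr (_ * _).
  by rewrite addnA -(addnA n) addnn addnAC [RHS]exprD -mul2n exprM sqrrN !expr1n mulr1.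
congr (\det _); apply/matrixP=> a b; rewrite !mxE; apply: appL.
by rewrite /= /bump [(n <= a)%N]leqNgt ltn_ord.
Qed.

Lemma adj_koszul_row (R : idomainType) m (A : 'M[R]_(3 + m, 3))
    (C : 'M[R]_(3 + m, m)) (h : 'rV[R]_3) :
  \adj (row_mx (A *m koszul h) C)
  = (row_mx h 0)^T *m (row_mx h 0 *m \adj (row_mx A C)).
Proof.
have -> : row_mx (A *m koszul h) C
        = row_mx A C *m block_mx (koszul h) 0 0 1%:M.
  by rewrite mul_row_block !mulmx0 mulmx1 addr0 add0r.
rewrite adj_mulmx adj_block_mx1 det_koszul adj_koszul mulmxA; congr (_ *m _).
by rewrite tr_row_mx mul_col_row trmx0 !mul0mx mulmx0 raddf0.
Qed.

Lemma koszul_row_kernel (R : comNzRingType) m (A : 'M[R]_(3 + m, 3))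
    (C : 'M[R]_(3 + m, m)) (h : 'rV[R]_3) :
  row_mx (A *m koszul h) C *m (row_mx h 0)^T = 0.
Proof.
by rewrite tr_row_mx mul_row_col -mulmxA mul_koszul_tr trmx0 !mulmx0 addr0.
Qed.

(** The vector [v0] defines the ideal, while [v] is the one in the resolution:
    being values of gamma, they differ by a unit, which is recovered by comparing
    both with [w]. *)
Lemma maxminors_generate (R : idomainType) m (A : 'M[R]_(3 + m, 3))
    (C : 'M[R]_(3 + m, m)) (h : 'rV[R]_3) (v0 v u : 'rV[R]_(3 + m)) :
  let M := row_mx (A *m koszul h) C in
  let rho : 'rV_(3 + m) := row_mx h 0 in
  let B := append_row (row_mx A C) rho in
  regular_sequence h -> is_gamma M v0 ->
  is_gamma M v -> exact_mx v M -> exact_mx M u^T -> is_gamma M^T rho ->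
  ideal_eq (ideal_gen (v0 0)) (ideal_gen (maxminor B)).
Proof.
move=> M rho B reg_h gamma_v0 gamma_v exact_vM exact_Mu gamma_rho.
pose w := rho *m \adj (row_mx A C).
have adjM : \adj M = rho^T *m w by apply: adj_koszul_row.
have exact_Mrho : exact_mx M rho^T.
  by apply: gamma_last_exact gamma_rho _ exact_Mu; apply: koszul_row_kernel.
have rhoE j : rho^T (lshift m j) 0 = h 0 j by rewrite mxE row_mxEl.
have [e e_neq0 wE] := gamma_scale gamma_v adjM.
(* Exactness at [v] makes [e] a unit; then [e0] divides [e *: v], hence [v],
   whose entries are coprime. *)
have [q q1] : rdvd e 1.
  apply: (@dvd_adj_unit _ (2 + m) v M rho^T exact_vM exact_Mrho e e_neq0
            (lshift m (0 : 'I_3)) (lshift m (1 : 'I_3))).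
    by move=> f; rewrite !rhoE; apply: regular_grade2.
  move=> i j; rewrite adjM mxE big_ord1 wE.
  by exists (rho^T j 0 * v 0 i); rewrite [(e *: v) 0 i]mxE; ring.
have [e0 _ wE0] := gamma_scale gamma_v0 adjM.
have wE0' i : w 0 i = e0 * v0 0 i by rewrite wE0 mxE.
have [q0 q01] : rdvd e0 1.
  apply: (gamma_coprime gamma_v) => i; exists (q * v0 0 i).
  by rewrite -mulrA [_ * e0]mulrC -wE0' wE mxE mulrA -q1 mul1r.
have [s ss minorE] : exists2 s : 'I_(3 + m) -> R, forall i, s i * s i = 1
    & forall i, maxminor B i = s i * e0 * v0 0 i.
  exists (fun i => (-1) ^+ (2 + m + i)) => i; first by rewrite -expr2 sqrr_sign.
  by rewrite maxminor_append_row -/rho -/w wE0' mulrA.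
move=> f; split; apply: ideal_gen_sub => i; last by exists (s i * e0).
exists (q0 * s i); rewrite minorE.
have -> : q0 * s i * (s i * e0 * v0 0 i) = (s i * s i) * (q0 * e0) * v0 0 i.
  by ring.
by rewrite ss -q01 !mul1r.
Qed.

End Main.

Theorem proposition2p14 (k : fieldType) (r : nat) (hr : (3 <= r)%N) (m : nat)
    (h : 'rV[{mpoly k[r]}]_3)
    (A : 'M[{mpoly k[r]}]_(3 + m, 3)) (C : 'M[{mpoly k[r]}]_(3 + m, m))
    (I : {mpoly k[r]} -> Prop) :
  let n := (3 + m)%N in
  let M : 'M[{mpoly k[r]}]_n := row_mx (A *m koszul h) C in
  let rho : 'rV[{mpoly k[r]}]_n := row_mx h 0 in
  let B : 'M[{mpoly k[r]}]_(n.+1, n) := append_row (row_mx A C) (row_mx h 0) in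
  homogeneous_mx A -> homogeneous_mx C ->
  is_ideal_of M I ->
  generalized_gorenstein3 I -> maximal_zeta I ->
  minimal_presentation_mx M ->
  is_gamma M^T rho -> is_last_map I rho^T ->
  regular_sequence h ->
  ideal_eq I (ideal_gen (maxminor B)).
Proof.
move=> n M rho B _ _ [v0 [gamma_v0 IE]] _ _ [_ [v [u [gamma_v _]]]].
move=> [_ [exact_vM exact_Mu _] _] gamma_rho _ reg_h f.
rewrite (IE f); move: f.
exact: (@maxminors_generate _ m A C h v0 v u).
Qed.
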